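(* Let $n\ge 2$, $m\ge 0$ and $c$ be integers, and define $k(n,m,c)$ as follows. - If $m=0$ and $4-2n\le 2c\le n-\epsilon_n$, let $k(n,m,c)=2\left\lfloor\dfrac{n+c+1+\epsilon_n}{3}\right\rfloor$. - If $m\ne 0$ and $4-2n-m+\epsilon_m\le 2c\le n-m-2\epsilon_n+3\epsilon_m-\epsilon_n\epsilon_m$, let $k(n,m,c)=2\left\lfloor\dfrac{2n+4m+2c-2+6\epsilon_n}{6}\right\rfloor$. - If $m\neq 0$ and $n-m+2-3\epsilon_n+3\epsilon_m\le 2c\le n+2m-3\epsilon_n$, let $k(n,m,c)=2\left\lfloor\dfrac{4n+2m-2c+2-2\epsilon_m}{6}\right\rfloor$. - Otherwise let $k(n,m,c)=0$. Then the $(\alpha+\beta)$-channel containing the alcove $(0,c)$ has exactly $k(n,m,c)$ elements in the shadow of $(n,m)$.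
   Context: $W=\langle s_0,s_1,s_2\mid s_i^2=1,(s_0s_1)^3=(s_0s_2)^3=(s_1s_2)^3=1\rangle$ is the Coxeter group of type $\tilde A_2$. Subscripts of generators are read modulo 3. For $k\ge 0$, $\gamma_i(k)=s_is_{i+1}s_{i+2}\cdots$ ($k$ letters, subscripts increasing by one mod 3) and $\delta_i(k)=s_is_{i-1}s_{i-2}\cdots$ ($k$ letters, subscripts decreasing by one mod 3). Put $\epsilon_k=1$ if $k$ is odd and $\epsilon_k=0$ if $k$ is even. Geometry: let $E=\{v\in\mathbb R^3: v_1+v_2+v_3=0\}$ with the standard inner product, and let $\alpha,\beta$ be simple roots of the root system of type $A_2$ in $E$ ($\langle\alpha,\alpha\rangle=\langle\beta,\beta\rangle=2$, $\langle\alpha,\beta\rangle=-1$). For a root $\gamma$ and $k\in\mathbb Z$ let $H_{\gamma,k}=\{x:\langle x,\gamma\rangle=k\}$. $W$ acts on $E$ by affine reflections: $s_2,s_1,s_0$ are the reflections in $H_{\alpha,0},H_{\beta,0},H_{\alpha+\beta,1}$. The identity alcove is $A_0=\{x:\langle x,\alpha\rangle\ge0,\langle x,\beta\rangle\ge0,\langle x,\alpha+\beta\rangle\le1\}$, and $w\in W$ is identified with the alcove $wA_0$. A $\gamma$-channel is an orbit of an alcove under the group generated by the reflections in the hyperplanes $H_{\gamma,k}$, $k\in\mathbb Z$. Coordinates: for $(n,m)\in\mathbb Z^2$ the alcove $(n,m)$ is the element $a(n,m)=b(n)\,c(n,m)\in W$, where $b(n)=\gamma_0(n)$ if $n\ge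 0$, $b(n)=\delta_2(-n)$ if $n<0$, and $c(n,m)=\delta_{n+1}(m)$ if $m\ge 0$, $c(n,m)=\gamma_{n+2}(-m)$ if $m<0$. Both parities of $n$ are allowed. Shadow: for $w\in W$ with reduced word $s_{i_1}\cdots s_{i_r}$, $\mathrm{Sh}(w)$ is the set of end alcoves $c_r$ of all (possibly folded) galleries $c_0=1,c_1,\dots,c_r$ with $c_t\in\{c_{t-1},c_{t-1}s_{i_t}\}$ for each $t$. It does not depend on the reduced word and equals the Bruhat interval $[1,w]$. *)

(* Defs.v *)
From HB Require Import structures.
From mathcomp Require Import all_boot all_order all_algebra all_fingroup.
From mathcomp Require Import generic_quotient.
From mathcomp Require Import boolp classical_sets functions cardinality reals.
From mathcomp Require Import ring lra.

Set Implicit Arguments.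
Unset Strict Implicit.
Unset Printing Implicit Defensive.

Import Order.TTheory GRing.Theory Num.Theory.

Local Open Scope ring_scope.
Local Open Scope classical_set_scope.
Local Open Scope quotient_scope.

(* Words in the generators; a letter lives in 'Z_3, so that subscripts are read
   modulo 3. *)
Definition word := seq 'Z_3.

(* Equality of words in the presented group. As the generators are involutions,
   the monoid with this presentation is already the group. *)
Inductive cox_eq : word -> word -> Prop :=
| cox_refl u : cox_eq u u
| cox_sym u v : cox_eq u v -> cox_eq v u
| cox_trans u v w : cox_eq u v -> cox_eq v w -> cox_eq u w
| cox_cat u u' v v' : cox_eq u u' -> cox_eq v v' -> cox_eq (u ++ v) (u' ++ v')
| cox_sqr i : cox_eq [:: i; i] [::]
| cox_braid i j : i != j -> cox_eq [:: i; j; i; j; i; j] [::].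

Definition cox_rel : rel word := fun u v => `[< cox_eq u v >].

Lemma cox_rel_refl : reflexive cox_rel.
Proof. by move=> u; apply/asboolP; exact: cox_refl. Qed.

Lemma cox_rel_sym : symmetric cox_rel.
Proof. by move=> u v; apply/asboolP/asboolP; exact: cox_sym. Qed.

Lemma cox_rel_trans : transitive cox_rel.
Proof.
by move=> v u w /asboolP uv /asboolP vw; apply/asboolP; exact: cox_trans vw.
Qed.

Canonical cox_equiv := EquivRel cox_rel cox_rel_refl cox_rel_sym cox_rel_trans.

Definition W := {eq_quot cox_equiv}.
HB.instance Definition _ := Choice.on W.
HB.instance Definition _ := Quotient.on W.

Lemma cox_piP (u v : word) : cox_eq u v <-> \pi_W u = \pi_W v.
Proof.
split=> [uv|/eqP].
  by apply/eqP; rewrite eqmodE; apply/asboolP.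
by rewrite eqmodE => /asboolP.
Qed.

Definition Wone : W := \pi_W [::].
Definition Wmul (x y : W) : W := \pi_W (repr x ++ repr y).
Definition Winv (x : W) : W := \pi_W (rev (repr x)).

Lemma Wmul_pi (u v : word) : Wmul (\pi_W u) (\pi_W v) = \pi_W (u ++ v).
Proof. by apply/cox_piP/cox_cat; apply/cox_piP; rewrite reprK. Qed.

Lemma WmulA : associative Wmul.
Proof.
elim/quotW=> u; elim/quotW=> v; elim/quotW=> w.
by rewrite (Wmul_pi v w) (Wmul_pi u v) (Wmul_pi u) (Wmul_pi (u ++ v)) catA.
Qed.

Lemma W1mul : left_id Wone Wmul.
Proof. by elim/quotW=> u; rewrite /Wone Wmul_pi. Qed.

Lemma Wmul1 : right_id Wone Wmul.
Proof. by elim/quotW=> u; rewrite /Wone Wmul_pi cats0. Qed.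

Lemma cox_rev (u : word) : cox_eq (u ++ rev u) [::].
Proof.
elim: u => [|i u IHu]; first exact: cox_refl.
rewrite rev_cons -cats1 /= catA -cat1s; apply: cox_trans (cox_sqr i).
apply: (cox_cat (cox_refl [:: i])); rewrite -[X in cox_eq _ X]cat0s.
exact: cox_cat IHu (cox_refl _).
Qed.

Lemma WmulV : right_inverse Wone Winv Wmul.
Proof.
move=> x; rewrite -{1}(reprK x) Wmul_pi; apply/cox_piP; exact: cox_rev.
Qed.

Lemma WVmul : left_inverse Wone Winv Wmul.
Proof.
move=> x; rewrite -{2}(reprK x) Wmul_pi; apply/cox_piP.
by rewrite -{2}(revK (repr x)); exact: cox_rev.
Qed.

HB.instance Definition _ := isGroup.Build W WmulA W1mul Wmul1 WVmul WmulV.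

Definition s (i : 'Z_3) : W := \pi_W [:: i].

Definition wprod (I : word) : W := (\big[*%g/1]_(i <- I) s i)%g.

Lemma wprodE (I : word) : wprod I = \pi_W I.
Proof.
rewrite /wprod; elim: I => [|i I IHI]; first by rewrite big_nil.
by rewrite big_cons IHI; exact: Wmul_pi.
Qed.

Definition reduced (I : word) : Prop :=
  forall J : word, wprod J = wprod I -> (size I <= size J)%N.

Definition gallery (I : word) (c : seq W) : Prop :=
  [/\ size c = (size I).+1,
      nth 1%g c 0 = 1%g &
      forall t, (t < size I)%N ->
        nth 1%g c t.+1 = nth 1%g c t \/
        nth 1%g c t.+1 = (nth 1%g c t * s (nth 0 I t))%g].

Definition shadow (w : W) : set W :=
  [set x | exists I c,
     [/\ reduced I, wprod I = w, gallery I c & last 1%g c = x]].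

Definition gamma_ (i : 'Z_3) (k : nat) : W :=
  wprod [seq i + j%:R | j <- iota 0 k].
Definition delta_ (i : 'Z_3) (k : nat) : W :=
  wprod [seq i - j%:R | j <- iota 0 k].

Definition b_ (n : int) : W :=
  if 0 <= n then gamma_ 0 `|n|%N else delta_ 2 `|n|%N.
Definition c_ (n m : int) : W :=
  if 0 <= m then delta_ (n + 1)%:~R `|m|%N else gamma_ (n + 2)%:~R `|m|%N.
Definition a_ (n m : int) : W := (b_ n * c_ n m)%g.

Section Geometry.
Variable R : realType.
Implicit Types (x y u v : 'rV[R]_3).

Definition inE3 v : Prop := \sum_i v 0 i = 0.

Definition dot u v : R := \sum_i u 0 i * v 0 i.

Definition A2_simple alpha beta : Prop :=
  [/\ inE3 alpha, inE3 beta, dot alpha alpha = 2, dot beta beta = 2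
    & dot alpha beta = - 1].

(* The orthogonal reflection in the hyperplane <x, v> = k. *)
Definition refl v (k : int) x : 'rV[R]_3 :=
  x - (2 * (dot x v - k%:~R) / dot v v) *: v.

Variables alpha beta : 'rV[R]_3.

Definition refl_gen (i : 'Z_3) : 'rV[R]_3 -> 'rV[R]_3 :=
  if i == 0 then refl (alpha + beta) 1
  else if i == 1 then refl beta 0
  else refl alpha 0.

Definition act_word (I : word) : 'rV[R]_3 -> 'rV[R]_3 :=
  foldr (fun i f => refl_gen i \o f) id I.

(* Independent of the representative word when A2_simple alpha beta holds: see
   act_pi. *)
Definition act (w : W) : 'rV[R]_3 -> 'rV[R]_3 := act_word (repr w).

Definition fund_alcove : set 'rV[R]_3 :=
  [set x | [/\ inE3 x, 0 <= dot x alpha, 0 <= dot x beta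
             & dot x (alpha + beta) <= 1]].

Definition alcove (w : W) : set 'rV[R]_3 := act w @` fund_alcove.

(* The group generated by the reflections in the hyperplanes <x, v> = k; these
   generators being involutions, closure under inverses is automatic. *)
Inductive refl_group v : ('rV[R]_3 -> 'rV[R]_3) -> Prop :=
| refl_group1 : refl_group v id
| refl_groupM k g : refl_group v g -> refl_group v (refl v k \o g).

(* The v-channel containing w, a set of alcoves, that is of elements of W. *)
Definition channel v (w : W) : set W :=
  [set u | exists2 g, refl_group v g & alcove u = g @` alcove w].

Lemma dotDl u v x : dot (u + v) x = dot u x + dot v x.
Proof.
by rewrite /dot -big_split; apply: eq_bigr => i _; rewrite !mxE mulrDl.
Qed.

Lemma dotC u v : dot u v = dot v u.
Proof. by apply: eq_bigr => i _; rewrite mulrC. Qed.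

Lemma dotDr u v x : dot x (u + v) = dot x u + dot x v.
Proof. by rewrite dotC dotDl !(dotC x). Qed.

Lemma dotZl a u v : dot (a *: u) v = a * dot u v.
Proof.
by rewrite /dot big_distrr; apply: eq_bigr => i _; rewrite /= !mxE mulrA.
Qed.

Lemma dotNl u v : dot (- u) v = - dot u v.
Proof. by rewrite -scaleN1r dotZl mulN1r. Qed.

Hypothesis simple : A2_simple alpha beta.

Lemma dot_simple :
  (dot alpha alpha = 2) * (dot beta beta = 2) * (dot alpha beta = - 1)
  * (dot beta alpha = - 1).
Proof. by have [_ _ ? ? ?] := simple; rewrite (dotC beta). Qed.

Lemma refl_genE (i : 'Z_3) x : refl_gen i x =
  if i == 0 then x - (dot x alpha + dot x beta - 1) *: (alpha + beta)
  else if i == 1 then x - dot x beta *: beta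
  else x - dot x alpha *: alpha.
Proof.
rewrite /refl_gen; case: ifP => _; last case: ifP => _.
all: rewrite /refl ?dotDl ?dotDr !dot_simple; congr (_ - _ *: _); by field.
Qed.

Lemma dot_refl_gen (i : 'Z_3) x :
  (dot (refl_gen i x) alpha =
     if i == 0 then 1 - dot x beta
     else if i == 1 then dot x alpha + dot x beta else - dot x alpha) *
  (dot (refl_gen i x) beta =
     if i == 0 then 1 - dot x alpha
     else if i == 1 then - dot x beta else dot x alpha + dot x beta).
Proof.
split; rewrite refl_genE; case: ifP => _; try (case: ifP => _);
by rewrite !(dotDl, dotNl, dotZl) !dot_simple; ring.
Qed.

Lemma act_word_cat (u v : word) : act_word (u ++ v) = act_word u \o act_word v.
Proof. by elim: u => //= i u ->. Qed.

Lemma act_word_cox (u v : word) : cox_eq u v -> act_word u =1 act_word v.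
Proof.
elim=> {u v} [//|u v _ IH x|u v w _ IH1 _ IH2 x|u u' v v' _ IH1 _ IH2 x|i x|
  i j neq_ij x].
- by rewrite IH.
- by rewrite IH1 IH2.
- by rewrite !act_word_cat /= IH2 IH1.
- rewrite /=; set y := refl_gen i x; rewrite (refl_genE i y) /y.
  rewrite !(dot_refl_gen i x) (refl_genE i x).
  by case: (i == 0); case: (i == 1); apply/rowP => k; rewrite !mxE; ring.
- rewrite /=; set y1 := refl_gen j x; set y2 := refl_gen i y1.
  set y3 := refl_gen j y2; set y4 := refl_gen i y3; set y5 := refl_gen j y4.
  rewrite (refl_genE i y5) /y5 !(dot_refl_gen j y4) (refl_genE j y4).
  rewrite /y4 !(dot_refl_gen i y3) (refl_genE i y3).
  rewrite /y3 !(dot_refl_gen j y2) (refl_genE j y2).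
  rewrite /y2 !(dot_refl_gen i y1) (refl_genE i y1).
  rewrite /y1 !(dot_refl_gen j x) (refl_genE j x).
  move: neq_ij; case: i {y2 y3 y4 y5} => [[|[|[|//]]] hi];
  case: j {y1} => [[|[|[|//]]] hj] //= _;
  apply/rowP => k; rewrite !mxE; move: (dot x alpha) (dot x beta) => p q;
  by move: (x 0 k) (alpha 0 k) (beta 0 k) => t a b; ring.
Qed.

Lemma act_pi (u : word) : act (\pi_W u) =1 act_word u.
Proof. by apply/act_word_cox/cox_piP; rewrite reprK. Qed.

Lemma actM (u v : W) : act (u * v)%g =1 act u \o act v.
Proof. by move=> x; rewrite act_pi act_word_cat. Qed.

Lemma act_gen (i : 'Z_3) : act (s i) =1 refl_gen i.
Proof. exact: act_pi. Qed.

End Geometry.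

Definition eps (k : int) : int := if odd `|k|%N then 1 else 0.

(* intdiv's %/ rounds down for a positive divisor, so it is the floor here. *)
Definition channel_size (n m c : int) : int :=
  if (m == 0) && (4 - 2 * n <= 2 * c <= n - eps n) then
    2 * ((n + c + 1 + eps n) %/ 3)%Z
  else if (m != 0) &&
    (4 - 2 * n - m + eps m <= 2 * c
       <= n - m - 2 * eps n + 3 * eps m - eps n * eps m) then
    2 * ((2 * n + 4 * m + 2 * c - 2 + 6 * eps n) %/ 6)%Z
  else if (m != 0) &&
    (n - m + 2 - 3 * eps n + 3 * eps m <= 2 * c <= n + 2 * m - 3 * eps n) then
    2 * ((4 * n + 2 * m - 2 * c + 2 - 2 * eps m) %/ 6)%Z
  else 0.

(* Main.v *)
(* Index the alcove containing an interior point x by the pair (k, d) of integers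
   with k = floor <x, alpha + beta> and d = floor <x, alpha> - floor <x, beta>.
   This makes W a brick wall Z^2: right multiplication by a generator crosses a
   wall of the alcove, hence moves to (k, d + 1), (k, d - 1) or (k +- 1, d)
   according to the residue of d modulo 3, and the reflections in the hyperplanes
   H_{alpha+beta,K} send (k, d) to (2K - 1 - k, d), so that the (alpha+beta)-channels
   are the columns d = const.  Counting separating hyperplanes gives the length
   function; Matsumoto's theorem, proved on this model, shows both that W acts
   faithfully on alcoves and that shadows do not depend on the reduced word.

   The shadow of (n, m) meets the column d in an interval 1 - H(d) <= k <= H(d).
   Appending a letter to the word changes H by an explicit local rule, and an
   induction on the letters of the word defining (n, m) identifies 2 H with the
   piecewise formula, whose six parity cases are "tents" with slopes +-1/3. *)

Require Import Defs.
From mathcomp Require Import all_boot all_order all_algebra all_fingroup finmap.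
From mathcomp Require Import zify ring lra generic_quotient.
From mathcomp Require Import boolp classical_sets cardinality reals.

Set Implicit Arguments.
Unset Strict Implicit.

Import Order.TTheory GRing.Theory Num.Theory.
Local Open Scope ring_scope.
Local Open Scope classical_set_scope.

(** * The brick wall model of the alcoves *)

Definition cell : Type := (int * int)%type.

(** Residue 0 of d + i marks the wall on a hyperplane H_{alpha+beta,K}, which lies above an alcove
    with k + d even and below one with k + d odd. *)
Definition cross (i : 'Z_3) (P : cell) : cell :=
  let: (k, d) := P in
  if ((d + i%:Z) %% 3)%Z == 1 then (k, d + 1)
  else if ((d + i%:Z) %% 3)%Z == 2 then (k, d - 1)
  else if ((k + d) %% 2)%Z == 0 then (k + 1, d) else (k - 1, d).

(* Alcoves pointing up and down, with a = floor <x, alpha> and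
   b = floor <x, beta>; these are the cells with k + d even, resp. odd. *)
Definition up (a b : int) : cell := (a + b, a - b).
Definition dn (a b : int) : cell := (a + b + 1, a - b).

Variant cell_spec : cell -> Type :=
  | CellUp a b : cell_spec (up a b)
  | CellDn a b : cell_spec (dn a b).

Lemma cellP (P : cell) : cell_spec P.
Proof.
case: P => k d; have [h|h] := boolP (((k + d) %% 2)%Z == 0).
  have -> : (k, d) = up ((k + d) %/ 2)%Z ((k - d) %/ 2)%Z.
    by congr pair; lia.
  exact: CellUp.
have -> : (k, d) = dn ((k + d) %/ 2)%Z ((k - d) %/ 2)%Z.
  by congr pair; lia.
exact: CellDn.
Qed.

Lemma cross_up i a b : cross i (up a b) =
  if ((a - b + i%:Z) %% 3)%Z == 1 then dn a (b - 1)
  else if ((a - b + i%:Z) %% 3)%Z == 2 then dn (a - 1) b else dn a b.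
Proof.
rewrite /cross /up /dn; case: ifP => _; first by congr pair; lia.
by case: ifP => _; [congr pair; lia | rewrite ifT //; lia].
Qed.

Lemma cross_dn i a b : cross i (dn a b) =
  if ((a - b + i%:Z) %% 3)%Z == 1 then up (a + 1) b
  else if ((a - b + i%:Z) %% 3)%Z == 2 then up a (b + 1) else up a b.
Proof.
rewrite /cross /up /dn; case: ifP => _; first by congr pair; lia.
case: ifP => _; first by congr pair; lia.
by rewrite ifF; [congr pair; lia | lia].
Qed.

Lemma up_floors a b :
  ((((up a b).1 + (up a b).2) %/ 2)%Z = a) *
  ((((up a b).1 - (up a b).2) %/ 2)%Z = b).
Proof. by split=> /=; lia. Qed.

Lemma dn_floors a b :
  ((((dn a b).1 + (dn a b).2) %/ 2)%Z = a) *
  ((((dn a b).1 - (dn a b).2) %/ 2)%Z = b).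
Proof. by split=> /=; lia. Qed.

(* The number of hyperplanes separating P from the identity alcove. *)
Definition dist (P : cell) : nat :=
  (`|P.1| + `|((P.1 + P.2) %/ 2)%Z| + `|((P.1 - P.2) %/ 2)%Z|)%N.

Lemma dist_up a b : dist (up a b) = (`|a| + `|b| + `|(a + b)%R|)%N.
Proof.
by rewrite /dist !up_floors /=; lia.
Qed.

Lemma dist_dn a b : dist (dn a b) = (`|a| + `|b| + `|(a + b + 1)%R|)%N.
Proof.
by rewrite /dist !dn_floors /=; lia.
Qed.

Lemma color_exists (d : int) (r : nat) :
  exists i : 'Z_3, ((d + i%:Z) %% 3)%Z = (r %% 3)%N.
Proof.
have h : (`|((r%:Z - d) %% 3)%Z| < 3)%N by lia.
by exists (Ordinal h) => /=; lia.
Qed.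

Lemma dist_cross_le (i : 'Z_3) (P : cell) : (dist (cross i P) <= (dist P).+1)%N.
Proof.
by case: (cellP P) => a b; rewrite ?cross_up ?cross_dn;
  (case: ifP => _; last case: ifP => _); rewrite dist_up dist_dn; lia.
Qed.

(** Some wall of a non-identity alcove separates it from the identity alcove; the signs of a and b
    tell which one. *)
Lemma descent (P : cell) : (0 < dist P)%N ->
  exists i : 'Z_3, (dist (cross i P)).+1 = dist P.
Proof.
case: (cellP P) => a b;
  have [i0 e0] := color_exists (a - b) 0;
  have [i1 e1] := color_exists (a - b) 1;
  have [i2 e2] := color_exists (a - b) 2; rewrite ?dist_up ?dist_dn => h.
- have [a_gt0|a_le0] := ltP 0 a.
    by exists i2; rewrite cross_up e2 /= dist_dn; lia.
  have [b_gt0|b_le0] := ltP 0 b.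
    by exists i1; rewrite cross_up e1 /= dist_dn; lia.
  by exists i0; rewrite cross_up e0 /= dist_dn; lia.
- have [a_lt0|a_ge0] := ltP a 0.
    by exists i1; rewrite cross_dn e1 /= dist_up; lia.
  have [b_lt0|b_ge0] := ltP b 0.
    by exists i2; rewrite cross_dn e2 /= dist_up; lia.
  by exists i0; rewrite cross_dn e0 /= dist_up; lia.
Qed.

Ltac color_cases :=
  rewrite ?cross_up ?cross_dn;
  repeat (case: ifP => ? ; rewrite ?cross_up ?cross_dn; try (exfalso; lia)).

Lemma crossK (i : 'Z_3) : involutive (cross i).
Proof.
by move=> P; case: (cellP P) => a b; color_cases; rewrite /up /dn;
  congr pair; lia.
Qed.

Lemma Z3_neq (i j : 'Z_3) : i != j -> i%:Z != j%:Z.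
Proof. by []. Qed.

Lemma cross_braid (i j : 'Z_3) (P : cell) : i != j ->
  cross i (cross j (cross i P)) = cross j (cross i (cross j P)).
Proof.
move=> /Z3_neq ij.
have hi : (i < 3)%N := ltn_ord i; have hj : (j < 3)%N := ltn_ord j.
by case: (cellP P) => a b; color_cases; rewrite /up /dn; congr pair; lia.
Qed.

(** If both crossings are descents, P is the farthest of the six alcoves around the vertex where its
    walls of colours i and j meet; the three hyperplanes through that vertex separate it from the
    opposite alcove. *)
Lemma dist_braid (i j : 'Z_3) (P : cell) : i != j ->
  (dist (cross i P)).+1 = dist P -> (dist (cross j P)).+1 = dist P ->
  ((dist (cross i (cross j (cross i P)))) + 3)%N = dist P.
Proof.
move=> /Z3_neq ij.
have hi : (i < 3)%N := ltn_ord i; have hj : (j < 3)%N := ltn_ord j.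
by case: (cellP P) => a b; color_cases; rewrite ?dist_up ?dist_dn; lia.
Qed.

(** * Reduced words and shadows *)

Definition endcell (I : word) : cell := foldl (fun P i => cross i P) (0, 0) I.

Lemma endcell_rcons I i : endcell (rcons I i) = cross i (endcell I).
Proof. by rewrite /endcell foldl_rcons. Qed.

Lemma dist_endcell I : (dist (endcell I) <= size I)%N.
Proof.
elim/last_ind: I => [//|I i IHI]; rewrite endcell_rcons size_rcons.
exact: leq_trans (dist_cross_le _ _) _.
Qed.

Lemma dist0_eq P : dist P = 0%N -> P = (0, 0).
Proof. by case: P => k d; rewrite /dist /= => h; congr pair; lia. Qed.

(** Geometric stand-in for [reduced], to which [reduced_short] shows it equivalent. *)
Definition short (I : word) : Prop := size I = dist (endcell I).

Lemma short_word P : exists2 I, short I & endcell I = P.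
Proof.
have [l] := ubnP (dist P); elim: l P => // l IHl P ltPl.
have [P0|Pgt0] := posnP (dist P).
  by exists [::]; rewrite ?(dist0_eq P0).
have [i di] := descent Pgt0.
have [|I sI eI] := IHl (cross i P); first by rewrite -ltnS di.
exists (rcons I i); last by rewrite endcell_rcons eI crossK.
by rewrite /short size_rcons endcell_rcons sI eI crossK.
Qed.

Lemma short_rcons I i : short (rcons I i) ->
  short I /\ (dist (endcell I)).+1 = dist (endcell (rcons I i)).
Proof.
rewrite /short size_rcons endcell_rcons => sI.
have := dist_endcell I; have := dist_cross_le i (endcell I); lia.
Qed.

(* Two different right descents i and j of P force a descent along the whole
   dihedral subgroup they generate (dist_braid), so that both words can be
   compared with words ending in i j i and j i j. *)
Lemma short_matsumoto (Q : word -> word -> Prop) :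
    (forall I, Q I I) -> (forall I J, Q I J -> Q J I) ->
    (forall I J K, Q I J -> Q J K -> Q I K) ->
    (forall I J i, Q I J -> Q (rcons I i) (rcons J i)) ->
    (forall I i j, i != j ->
       Q (rcons (rcons (rcons I i) j) i) (rcons (rcons (rcons I j) i) j)) ->
  forall I J, short I -> short J -> endcell I = endcell J -> Q I J.
Proof.
move=> Qrefl Qsym Qtrans Qrcons Qbraid I J.
have [l] := ubnP (size I); elim: l I J => // l IHl I J.
case/lastP: I => [|I i].
  case/lastP: J => [//|J j] _ _ + e.
  by rewrite /short size_rcons -e.
case/lastP: J => [|J j].
  by move=> _ + _ e; rewrite /short size_rcons e.
rewrite size_rcons ltnS => ltIl sI sJ e.
have [sI' dI] := short_rcons sI; have [sJ' dJ] := short_rcons sJ.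
set P := endcell (rcons I i) in e dI.
have eI : endcell I = cross i P by rewrite /P endcell_rcons crossK.
have eJ : endcell J = cross j P by rewrite e endcell_rcons crossK.
have [eij|neq_ij] := eqVneq i j.
  by rewrite -eij in eJ *; apply/Qrcons/IHl => //; rewrite eI eJ.
rewrite eI in dI; rewrite eJ -e in dJ.
have d3 := dist_braid neq_ij dI dJ.
have [K sK eK] := short_word (cross i (cross j (cross i P))).
have ltJl : (size J < l)%N by rewrite sJ' eJ -ltnS dJ -dI ltnS -eI -sI'.
have QI : Q I (rcons (rcons K i) j).
  apply: IHl => //; last by rewrite !endcell_rcons eK !crossK.
  by rewrite /short !size_rcons !endcell_rcons sK eK !crossK; lia.
have QJ : Q J (rcons (rcons K j) i).
  apply: IHl => //; last by rewrite !endcell_rcons eK cross_braid // !crossK.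
  rewrite /short !size_rcons !endcell_rcons sK eK.
  by rewrite cross_braid // !crossK -cross_braid //; lia.
apply: (Qtrans _ _ _ (Qrcons _ _ i QI)).
apply: (Qtrans _ _ _ (Qbraid _ _ _ neq_ij)).
exact/Qsym/Qrcons.
Qed.

Lemma wprod_rcons I i : wprod (rcons I i) = (wprod I * s i)%g.
Proof. by rewrite /wprod -cats1 big_cat big_seq1. Qed.

Lemma s_sqr (i : 'Z_3) : (s i * s i = 1)%g.
Proof.
have := wprodE [:: i; i]; rewrite /wprod !big_cons big_nil mulg1 => ->.
exact/cox_piP/cox_sqr.
Qed.

Lemma s_braid i j : i != j -> (s i * s j * s i = s j * s i * s j)%g.
Proof.
move=> ij; have h : (s i * s j * s i * s j * s i * s j = 1)%g.
  have := wprodE [:: i; j; i; j; i; j].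
  rewrite /wprod !big_cons big_nil mulg1 !mulgA => ->.
  exact/cox_piP/cox_braid.
have sK x k : (x * s k * s k = x)%g by rewrite -mulgA s_sqr mulg1.
transitivity ((s i * s j * s i * s j * s i * s j) * (s j * s i * s j))%g.
  by rewrite !mulgA !sK.
by rewrite h mul1g.
Qed.

(** Crossings satisfy the Coxeter relations, by [crossK] and [cross_braid], so they define a right
    action of W on cells. *)
Lemma endcell_wprod (I J : word) : wprod I = wprod J -> endcell I = endcell J.
Proof.
rewrite !wprodE => /cox_piP; rewrite /endcell.
(* The starting cell is generalized because the second factor of a concatenation starts wherever the
   first one ends. *)
move: (0, 0) => P e; elim: e P => {I J} [//|I J _ IH P|I J K _ IH1 _ IH2 P|
  I I' J J' _ IH1 _ IH2 P|i P|i j ij P].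
- by rewrite IH.
- by rewrite IH1.
- by rewrite !foldl_cat IH1 IH2.
- by rewrite /= crossK.
- by rewrite /= (cross_braid _ ij) // !crossK.
Qed.

Lemma short_wprod I J :
  short I -> short J -> endcell I = endcell J -> wprod I = wprod J.
Proof.
apply: (@short_matsumoto (fun I J => wprod I = wprod J)).
- by [].
- by [].
- by move=> ? ? ? -> ->.
- by move=> ? ? i h; rewrite !wprod_rcons h.
- by move=> K i j ij; rewrite !wprod_rcons -!mulgA !(mulgA (s _)) s_braid.
Qed.

(** Crossing a wall changes the parity of [dist]; together with [dist_cross_le] the change is
    exactly one. *)
Lemma dist_cross_neq i P : dist (cross i P) <> dist P.
Proof.
by case: (cellP P) => a b; rewrite ?cross_up ?cross_dn;
  (case: ifP => _; last case: ifP => _); rewrite dist_up dist_dn; lia.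
Qed.

Lemma wprod_short I : exists2 J, short J & wprod J = wprod I.
Proof.
elim/last_ind: I => [|I i [J sJ eJ]]; first by exists [::].
rewrite wprod_rcons -eJ -wprod_rcons.
have [K sK eK] := short_word (cross i (endcell J)).
have := dist_cross_le i (endcell J).
have := dist_cross_le i (cross i (endcell J)); rewrite crossK.
have := @dist_cross_neq i (endcell J) => neq le1 le2.
have [lt|le] := leqP (dist (cross i (endcell J))) (dist (endcell J)).
  (* The crossing is a descent, so the cell of [J] also has a short word ending in i. Its product
     equals that of [J] by [short_wprod], and the two final letters i cancel. *)
  have sKi : short (rcons K i).
    by rewrite /short size_rcons endcell_rcons sK eK crossK; lia.
  exists K => //; rewrite wprod_rcons (short_wprod sJ sKi) ?wprod_rcons.
    by rewrite -mulgA s_sqr mulg1.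
  by rewrite endcell_rcons eK crossK.
exists (rcons J i) => //; rewrite /short size_rcons endcell_rcons sJ; lia.
Qed.

(** Faithfulness of the action: after passing to short words, this is the Matsumoto argument. *)
Lemma wprod_endcell I J : endcell I = endcell J -> wprod I = wprod J.
Proof.
have [I' sI eI] := wprod_short I; have [J' sJ eJ] := wprod_short J.
rewrite -(endcell_wprod eI) -(endcell_wprod eJ) -eI -eJ.
exact: short_wprod.
Qed.

Lemma reduced_short I : reduced I <-> short I.
Proof.
split=> [rI|sI J e]; last by rewrite sI -(endcell_wprod e) dist_endcell.
have [J sJ eJ] := wprod_short I; apply/eqP; rewrite eqn_leq dist_endcell andbT.
by rewrite -(endcell_wprod eJ) -sJ rI.
Qed.

(** * The bijection between W and cells, and folded galleries *)

Definition cellW (w : W) : cell := endcell (repr w).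

Lemma cellW_wprod I : cellW (wprod I) = endcell I.
Proof. by apply: endcell_wprod; rewrite !wprodE reprK. Qed.

Lemma cellW1 : cellW 1%g = (0, 0).
Proof. by have := cellW_wprod [::]; rewrite /wprod big_nil. Qed.

Lemma cellWE (w : W) : exists2 I, w = wprod I & cellW w = endcell I.
Proof. by exists (repr w); rewrite // wprodE reprK. Qed.

Lemma cellW_inj : injective cellW.
Proof.
move=> u v; have [I -> ->] := cellWE u; have [J -> ->] := cellWE v.
exact: wprod_endcell.
Qed.

Lemma cellW_mul_s (w : W) (i : 'Z_3) : cellW (w * s i)%g = cross i (cellW w).
Proof.
by have [I -> ->] := cellWE w; rewrite -wprod_rcons cellW_wprod endcell_rcons.
Qed.

Lemma cellW_surj P : exists w, cellW w = P.
Proof.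
by have [I _ <-] := short_word P; exists (wprod I); rewrite cellW_wprod.
Qed.

(** End cells of the folded galleries of type [I]: at each letter a gallery stays or crosses, and as
    [cross i] is an involution, the image of a set under it is also its preimage. *)
Definition shade (I : word) : pred cell :=
  foldl (fun S i => [pred P | S P || S (cross i P)]) (pred1 (0, 0)) I.

Lemma shade_nil P : shade [::] P = (P == (0, 0)).
Proof. by []. Qed.

Lemma shade_rcons I i P :
  shade (rcons I i) P = shade I P || shade I (cross i P).
Proof. by rewrite /shade foldl_rcons. Qed.

Lemma shade_short I J :
  short I -> short J -> endcell I = endcell J -> shade I =1 shade J.
Proof.
apply: (@short_matsumoto (fun I J => shade I =1 shade J)).
- by [].
- by move=> ? ? h P; rewrite h.
- by move=> ? ? ? h h' P; rewrite h h'.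
- by move=> ? ? i h P; rewrite !shade_rcons !h.
(* Both sides are the disjunction of [shade K] over the same six cells, obtained from P by crossing
   walls of colours i and j. *)
- move=> K i j ij P; rewrite !shade_rcons !crossK cross_braid //.
  by do 6!case: (shade _ _).
Qed.

Lemma galleryP (I : word) (x : W) :
  (exists2 c, gallery I c & last 1%g c = x) <-> shade I (cellW x).
Proof.
elim/last_ind: I x => [|I i IHI] x.
  split=> [[c [sc c0 _] <-]|/eqP x0].
    case: c sc c0 => [//|y [|//]] _ /= ->.
    by rewrite cellW1.
  exists [:: 1%g] => //=; apply: cellW_inj.
  by rewrite x0 cellW1.
rewrite shade_rcons; split.
  case=> c [sc c0 hc] <-; case/lastP: c sc c0 hc => [//|c y].
  rewrite !size_rcons => -[sc] c0 hc; rewrite last_rcons.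
  have gc : gallery I c.
    split=> //.
      by move: c0; rewrite nth_rcons sc.
    move=> t tI; have := hc t (ltnW tI).
    by rewrite !nth_rcons sc !ltnS tI (ltnW tI).
  have hl : last 1%g c = nth 1%g c (size I) by rewrite -nth_last sc.
  have := hc (size I) (ltnSn _).
  rewrite !nth_rcons sc !ltnn !eqxx ltnS leqnn -hl.
  case=> ->; apply/orP.
    by left; apply/IHI; exists c.
  right; rewrite cellW_mul_s crossK; apply/IHI; exists c => //.
have ext z : shade I (cellW z) -> x = z \/ x = (z * s i)%g ->
    exists2 c, gallery (rcons I i) c & last 1%g c = x.
  move=> /IHI[c [sc c0 hc] lc] hx.
  exists (rcons c x); last by rewrite last_rcons.
  split; first by rewrite !size_rcons sc.
    by rewrite nth_rcons sc.
  move=> t; rewrite size_rcons ltnS leq_eqVlt => /predU1P[->|tI].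
    rewrite !nth_rcons sc !ltnn eqxx ltnS leqnn eqxx.
    by rewrite -[size I]/((size I).+1.-1) -sc nth_last lc.
  by rewrite !nth_rcons sc !ltnS tI (ltnW tI); exact: hc.
case/orP=> h; first by apply: ext h _; left.
apply: (ext (x * s i)%g); first by rewrite cellW_mul_s.
by right; rewrite -mulgA s_sqr mulg1.
Qed.

Lemma shadow_shade I x : short I -> shadow (wprod I) x <-> shade I (cellW x).
Proof.
move=> sI; split.
  case=> J [c [/reduced_short sJ eJ gc lc]].
  rewrite (@shade_short I J) //; last exact/esym/endcell_wprod.
  by apply/galleryP; exists c.
move=> /galleryP[c gc lc]; exists I, c; split=> //; exact/reduced_short.
Qed.

(** * Alcoves and channels in the plane *)

(* The action of W on the left, as opposed to cross; the two commute. *)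
Definition mirror (i : 'Z_3) (P : cell) : cell :=
  let: (k, d) := P in
  let a := ((k + d) %/ 2)%Z in let b := ((k - d) %/ 2)%Z in
  if i == 0 then (1 - k, d)
  else if i == 1 then (a, k + 1 + b) else (b, - 1 - k - a).

Lemma mirror_up i a b : mirror i (up a b) =
  if i == 0 then dn (- b) (- a)
  else if i == 1 then dn (a + b) (- 1 - b) else dn (- 1 - a) (a + b).
Proof.
rewrite /mirror /up /dn.
by case: ifP => _; last case: ifP => _; congr pair; lia.
Qed.

Lemma mirror_dn i a b : mirror i (dn a b) =
  if i == 0 then up (- b) (- a)
  else if i == 1 then up (a + b + 1) (- 1 - b) else up (- 1 - a) (a + b + 1).
Proof.
rewrite /mirror /up /dn.
by case: ifP => _; last case: ifP => _; congr pair; lia.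
Qed.

Lemma mirror_cross i j P : mirror i (cross j P) = cross j (mirror i P).
Proof.
by case: (cellP P) => a b; case h0: (i == 0); case h1: (i == 1);
  rewrite !(mirror_up, mirror_dn) ?h0 ?h1; color_cases;
  rewrite !(mirror_up, mirror_dn) ?h0 ?h1; rewrite /up /dn; congr pair; lia.
Qed.

Lemma mirrorK i : involutive (mirror i).
Proof.
by move=> P; case: (cellP P) => a b; case h0: (i == 0); case h1: (i == 1);
  rewrite !(mirror_up, mirror_dn) ?h0 ?h1 !(mirror_up, mirror_dn) ?h0 ?h1;
  rewrite /up /dn; congr pair; lia.
Qed.

Lemma cross0_mirror i : cross i (0, 0) = mirror i (0, 0).
Proof. by case: i => -[|[|[|]]]. Qed.

(** Bridge between [endcell], which grows words on the right, and [act_word], which applies the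
    first letter last: [mirror] commutes with [cross] and agrees with it on the identity cell. *)
Lemma endcell_cons i I : endcell (i :: I) = mirror i (endcell I).
Proof.
rewrite [LHS]/(foldl (fun P j => cross j P) (cross i (0, 0)) I).
rewrite cross0_mirror /endcell.
elim: I (0, 0) => //= j I IHI P.
by rewrite -mirror_cross IHI.
Qed.

Section Alcoves.
Variables (R : realType) (alpha beta : 'rV[R]_3).
Hypothesis simple : A2_simple alpha beta.
Implicit Types (x v : 'rV[R]_3).

(* Three of the six inequalities are redundant, which three depending on the
   parity of P.1 + P.2. *)
Definition cell_alcove (P : cell) : set 'rV[R]_3 :=
  [set x | [/\ inE3 x, P.1%:~R <= dot x alpha + dot x beta <= P.1%:~R + 1,
    ((P.1 + P.2) %/ 2)%Z%:~R <= dot x alpha <= ((P.1 + P.2) %/ 2)%Z%:~R + 1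
  & ((P.1 - P.2) %/ 2)%Z%:~R <= dot x beta <= ((P.1 - P.2) %/ 2)%Z%:~R + 1]].

Lemma cell_alcove_up a b x : cell_alcove (up a b) x <->
  [/\ inE3 x, a%:~R <= dot x alpha, b%:~R <= dot x beta
    & dot x alpha + dot x beta <= a%:~R + b%:~R + 1].
Proof.
rewrite /cell_alcove !up_floors /= rmorphD /=.
split=> [[xE /andP[? ?] /andP[? ?] /andP[? ?]]|[xE ? ? ?]]; split=> //; lra.
Qed.

Lemma cell_alcove_dn a b x : cell_alcove (dn a b) x <->
  [/\ inE3 x, dot x alpha <= a%:~R + 1, dot x beta <= b%:~R + 1
    & a%:~R + b%:~R + 1 <= dot x alpha + dot x beta].
Proof.
rewrite /cell_alcove !dn_floors /= !rmorphD /=.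
split=> [[xE /andP[? ?] /andP[? ?] /andP[? ?]]|[xE ? ? ?]]; split=> //; lra.
Qed.

Lemma fund_alcoveE : fund_alcove alpha beta = cell_alcove (0, 0).
Proof.
rewrite -[(0, 0)]/(up 0 0); apply/seteqP; split=> x.
  move=> [xE h1 h2]; rewrite dotDr => h3.
  by apply/cell_alcove_up; split=> //; lra.
by move=> /cell_alcove_up[xE h1 h2 h3]; split; rewrite ?dotDr //; lra.
Qed.

Lemma inE3_refl v (k : int) x : inE3 v -> inE3 x -> inE3 (refl v k x).
Proof.
rewrite /inE3 /refl => v0 x0; set t := _ / _.
under eq_bigr do rewrite !mxE.
by rewrite big_split /= x0 add0r sumrN -mulr_sumr v0 mulr0 oppr0.
Qed.

Lemma inE3_theta : inE3 (alpha + beta).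
Proof.
have [aE bE _ _ _] := simple; rewrite /inE3.
by under eq_bigr do rewrite mxE; rewrite big_split /= aE bE addr0.
Qed.

Lemma inE3_refl_gen i x : inE3 x -> inE3 (refl_gen alpha beta i x).
Proof.
have [aE bE _ _ _] := simple; have abE := inE3_theta.
by rewrite /refl_gen; case: ifP => _; last case: ifP => _; exact: inE3_refl.
Qed.

Lemma refl_genK i : involutive (refl_gen alpha beta i).
Proof. by move=> x; exact: (act_word_cox simple (cox_sqr i)). Qed.

Lemma refl_gen_cell_alcove i P x : cell_alcove P x ->
  cell_alcove (mirror i P) (refl_gen alpha beta i x).
Proof.
case: (cellP P) => a b.
  move=> /cell_alcove_up[xE h1 h2 h3]; rewrite mirror_up.
  have := inE3_refl_gen i xE; have := dot_refl_gen simple i x.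
  by case: ifP => _; last case: ifP => _; move=> [e1 e2] yE;
    apply/cell_alcove_dn; rewrite e1 e2 ?rmorphD ?rmorphN /=; split=> //; lra.
move=> /cell_alcove_dn[xE h1 h2 h3]; rewrite mirror_dn.
have := inE3_refl_gen i xE; have := dot_refl_gen simple i x.
by case: ifP => _; last case: ifP => _; move=> [e1 e2] yE;
  apply/cell_alcove_up; rewrite e1 e2 ?rmorphD ?rmorphN /=; split=> //; lra.
Qed.

Lemma refl_gen_image i P :
  refl_gen alpha beta i @` cell_alcove P = cell_alcove (mirror i P).
Proof.
apply/seteqP; split=> [_ [x Px <-]|x Px]; first exact: refl_gen_cell_alcove.
exists (refl_gen alpha beta i x); last exact: refl_genK.
by rewrite -[P](mirrorK i); exact: refl_gen_cell_alcove.
Qed.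

Lemma alcoveE (w : W) : alcove alpha beta w = cell_alcove (cellW w).
Proof.
rewrite /alcove /Defs.act /cellW; elim: (repr w) => [|i I IHI].
  by rewrite fund_alcoveE; exact: image_id.
by rewrite endcell_cons -refl_gen_image -IHI; exact/esym/image_comp.
Qed.

Lemma point_exists (p q : R) :
  exists x, [/\ inE3 x, dot x alpha = p & dot x beta = q].
Proof.
have [aE bE _ _ _] := simple.
(* The coefficients come from the inverse of the Cartan matrix of A2. *)
exists ((2 * p + q) / 3 *: alpha + (p + 2 * q) / 3 *: beta); split.
- rewrite /inE3; under eq_bigr do rewrite !mxE.
  by rewrite big_split /= -!mulr_sumr aE bE !mulr0 addr0.
- by rewrite dotDl !dotZl !(dot_simple simple); field.
- by rewrite dotDl !dotZl !(dot_simple simple); field.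
Qed.

Lemma lt_add1_int (a b : int) (t : R) : a%:~R <= t -> t < b%:~R + 1 -> a <= b.
Proof.
move=> h1 h2; have : (a%:~R : R) < (b + 1)%:~R by rewrite rmorphD /=; lra.
by rewrite ltr_int; lia.
Qed.

Lemma le_add1_int (a b : int) (t : R) : a%:~R < t -> t <= b%:~R + 1 -> a <= b.
Proof.
move=> h1 h2; have : (a%:~R : R) < (b + 1)%:~R by rewrite rmorphD /=; lra.
by rewrite ltr_int; lia.
Qed.

(** An interior point lies strictly inside the three strips bounding its alcove, so its floors, and
    with them the cell, can be recovered. *)
Lemma cell_alcove_inj : injective cell_alcove.
Proof.
suff h P Q : cell_alcove P = cell_alcove Q -> P = Q by [].
have [x cx] : exists x, [/\ cell_alcove P x,
    P.1%:~R < dot x alpha + dot x beta < P.1%:~R + 1,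
    ((P.1 + P.2) %/ 2)%Z%:~R < dot x alpha < ((P.1 + P.2) %/ 2)%Z%:~R + 1
  & ((P.1 - P.2) %/ 2)%Z%:~R < dot x beta < ((P.1 - P.2) %/ 2)%Z%:~R + 1].
  case: (cellP P) => a b.
    (* The interior point is the centroid, with fractional parts 1/3 in an upward alcove and 2/3 in
       a downward one. *)
    have [x [xE pE qE]] := point_exists (a%:~R + 3^-1) (b%:~R + 3^-1).
    exists x; rewrite !up_floors pE qE /= rmorphD /=; split; try lra.
    by apply/cell_alcove_up; rewrite pE qE; split=> //; lra.
  have [x [xE pE qE]] := point_exists (a%:~R + 2 / 3) (b%:~R + 2 / 3).
  exists x; rewrite !dn_floors pE qE /= !rmorphD /=; split; try lra.
  by apply/cell_alcove_dn; rewrite pE qE; split=> //; lra.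
move=> ePQ; move: cx; rewrite ePQ.
move=> [[_ /andP[a1 a2] /andP[a3 a4] /andP[a5 a6]]].
move=> /andP[b1 b2] /andP[b3 b4] /andP[b5 b6].
have := (lt_add1_int a1 b2, lt_add1_int a3 b4, lt_add1_int a5 b6).
have := (le_add1_int b1 a2, le_add1_int b3 a4, le_add1_int b5 a6).
case: P Q {ePQ a1 a2 a3 a4 a5 a6 b1 b2 b3 b4 b5 b6} => [k d] [k' d'] /=.
by move=> [[? ?] ?] [[? ?] ?]; congr pair; lia.
Qed.

Lemma dot_refl_theta (K : int) x :
  (dot (refl (alpha + beta) K x) alpha = K%:~R - dot x beta) *
  (dot (refl (alpha + beta) K x) beta = K%:~R - dot x alpha).
Proof.
by split; rewrite /refl !(dotDl, dotNl, dotZl, dotDr) !(dot_simple simple);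
  field.
Qed.

Lemma reflK v (K : int) : dot v v != 0 -> involutive (refl v K).
Proof.
move=> vv x; rewrite /refl !(dotDl, dotNl, dotZl).
by apply/rowP => j; rewrite !mxE; field.
Qed.

Lemma refl_theta_cell_alcove (K k d : int) x : cell_alcove (k, d) x ->
  cell_alcove (2 * K - 1 - k, d) (refl (alpha + beta) K x).
Proof.
have [e1 e2] := dot_refl_theta K x; have abE := inE3_theta.
case eP : (k, d) / (cellP (k, d)) => [a b|a b].
  move=> /cell_alcove_up[xE h1 h2 h3].
  have -> : (2 * K - 1 - k, d) = dn (K - 1 - b) (K - 1 - a).
    by case: eP => -> ->; congr pair; lia.
  apply/cell_alcove_dn; rewrite e1 e2 !rmorphB /=.
  by split; [exact: inE3_refl|lra|lra|lra].
move=> /cell_alcove_dn[xE h1 h2 h3].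
have -> : (2 * K - 1 - k, d) = up (K - 1 - b) (K - 1 - a).
  by case: eP => -> ->; congr pair; lia.
apply/cell_alcove_up; rewrite e1 e2 !rmorphB /=.
by split; [exact: inE3_refl|lra|lra|lra].
Qed.

Lemma refl_theta_image (K k d : int) :
  refl (alpha + beta) K @` cell_alcove (k, d) = cell_alcove (2 * K - 1 - k, d).
Proof.
have tt : dot (alpha + beta) (alpha + beta) != 0.
  have -> : dot (alpha + beta) (alpha + beta) = 2%:R.
    by rewrite dotDl !dotDr !(dot_simple simple); ring.
  by rewrite pnatr_eq0.
apply/seteqP; split=> [_ [x Px <-]|x Px]; first exact: refl_theta_cell_alcove.
exists (refl (alpha + beta) K x); last exact: reflK.
have -> : k = 2 * K - 1 - (2 * K - 1 - k) by lia.
exact: refl_theta_cell_alcove.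
Qed.

Lemma refl_group_theta_image g k d : refl_group (alpha + beta) g ->
  exists k', g @` cell_alcove (k, d) = cell_alcove (k', d).
Proof.
elim=> [|K {}g _ [k' IH]]; first by exists k; rewrite image_id.
by exists (2 * K - 1 - k'); rewrite -image_comp IH refl_theta_image.
Qed.

Lemma refl_group_theta_trans k k' d : exists2 g, refl_group (alpha + beta) g &
  g @` cell_alcove (k, d) = cell_alcove (k', d).
Proof.
suff h (n : nat) : (exists2 g, refl_group (alpha + beta) g &
      g @` cell_alcove (k, d) = cell_alcove (k + n%:Z, d)) /\
    (exists2 g, refl_group (alpha + beta) g &
      g @` cell_alcove (k, d) = cell_alcove (k - n%:Z, d)).
  have [le|lt] := lerP k k'.
    have [+ _] := h `|k' - k|%N; have -> // : k + `|k' - k|%N%:Z = k' by lia.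
  have [_ +] := h `|k' - k|%N; have -> // : k - `|k' - k|%N%:Z = k' by lia.
elim: n => [|n [[g1 G1 e1] [g2 G2 e2]]].
  by split; exists id; rewrite ?image_id ?addr0 ?subr0 //; exact: refl_group1.
split.
  (* The reflecting hyperplane is the one between the current row and the next: K = k + n + 1 going
     up, K = k - n going down. *)
  exists (refl (alpha + beta) (k + n%:Z + 1) \o g1); first exact: refl_groupM.
  by rewrite -image_comp e1 refl_theta_image; congr (cell_alcove (_, _)); lia.
exists (refl (alpha + beta) (k - n%:Z) \o g2); first exact: refl_groupM.
by rewrite -image_comp e2 refl_theta_image; congr (cell_alcove (_, _)); lia.
Qed.

Lemma channel_theta (u w : W) :
  channel alpha beta (alpha + beta) w u <-> (cellW u).2 = (cellW w).2.
Proof.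
rewrite /channel /= !alcoveE.
case: (cellW w) => k d; case eu: (cellW u) => [k1 d1] /=; split.
  case=> g /(refl_group_theta_image k d)[k' ->].
  by move=> /cell_alcove_inj[].
by move=> ->; have [g G e] := refl_group_theta_trans k k1 d; exists g.
Qed.
End Alcoves.

(** * Heights of the columns of a shadow *)

Definition tent (lo mid hi u v c : int) : int :=
  if lo <= c <= mid then ((u + c) %/ 3)%Z
  else if mid < c <= hi then ((v - c) %/ 3)%Z else 0.

(** Each floor quotient is traded for an integer y with its two defining inequalities, which keeps
    the case analysis linear. *)
Variant tent_spec (lo mid hi u v c : int) : int -> Prop :=
| TentLt of c < lo : tent_spec lo mid hi u v c 0
| TentL y of lo <= c & c <= mid & 3 * y <= u + c & u + c < 3 * y + 3 :
    tent_spec lo mid hi u v c y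
| TentR y of mid < c & c <= hi & 3 * y <= v - c & v - c < 3 * y + 3 :
    tent_spec lo mid hi u v c y
| TentGt of hi < c : tent_spec lo mid hi u v c 0.

Lemma tentP lo mid hi u v : lo <= mid + 1 -> mid <= hi -> forall c,
   tent_spec lo mid hi u v c (tent lo mid hi u v c).
Proof.
move=> h1 h2 c; rewrite /tent.
have [lt|le] := ltP c lo; first by rewrite /= ifF; [exact: TentLt|lia].
have [lt|le2] := leP c mid; first by rewrite /=; apply: TentL; lia.
by rewrite /=; have [lt|le3] := leP c hi; [apply: TentR; lia|apply: TentGt].
Qed.

(* If the column d of a shadow is 1 - H d <= k <= H d, then appending the letter
   e gives column heights raise e H (slab_rcons): two adjacent columns are
   levelled, or a column grows when its top cell has its upper wall of colour e. *)
Definition raise (e : int) (H : int -> int) (d : int) : int :=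
  if ((d + e) %% 3)%Z == 1 then Num.max (H d) (H (d + 1))
  else if ((d + e) %% 3)%Z == 2 then Num.max (H d) (H (d - 1))
  else if (0 < H d) && ((H d - d) %% 2 == 0)%Z then H d + 1 else H d.

(** Residues and parities become explicit witnesses q and r, and each maximum becomes two
    overlapping cases with weak inequalities, again for linear arithmetic. *)
Variant raise_spec (e : int) (H : int -> int) (d : int) : int -> Prop :=
| RaiseR q of d + e = 3 * q + 1 & H (d + 1) <= H d : raise_spec e H d (H d)
| RaiseR' q of d + e = 3 * q + 1 & H d <= H (d + 1) :
    raise_spec e H d (H (d + 1))
| RaiseL q of d + e = 3 * q + 2 & H (d - 1) <= H d : raise_spec e H d (H d)
| RaiseL' q of d + e = 3 * q + 2 & H d <= H (d - 1) :
    raise_spec e H d (H (d - 1))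
| RaiseU q r of d + e = 3 * q & 0 < H d & H d - d = 2 * r :
    raise_spec e H d (H d + 1)
| RaiseU' q r of d + e = 3 * q & H d - d = 2 * r + 1 : raise_spec e H d (H d)
| RaiseU0 q of d + e = 3 * q & H d <= 0 : raise_spec e H d (H d).

Lemma raiseP e H d : raise_spec e H d (raise e H d).
Proof.
rewrite /raise; case: ifP => [h1|h1].
  have e1 : d + e = 3 * ((d + e) %/ 3)%Z + 1 by lia.
  case: leP => h; [apply: RaiseR' e1 h|apply: RaiseR e1 (ltW h)].
case: ifP => [h2|h2].
  have e2 : d + e = 3 * ((d + e) %/ 3)%Z + 2 by lia.
  case: leP => h; [apply: RaiseL' e2 h|apply: RaiseL e2 (ltW h)].
have e3 : d + e = 3 * ((d + e) %/ 3)%Z by lia.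
have [h|h] := ltP 0 (H d) => /=; last exact: RaiseU0 e3 h.
case: ifP => h3.
  by apply: (RaiseU (r := ((H d - d) %/ 2)%Z) e3 h); lia.
by apply: (RaiseU' (r := ((H d - d) %/ 2)%Z) e3); lia.
Qed.

(* Half of channel_size n m, by the parities of n = 2 h or 2 h + 1 and
   m = 2 t or 2 t + 1; the formulas for m = 0 are not those for t = 0. *)
Definition tent_ee (h t : int) :=
  tent (2 - 2 * h - t) (h - t) (h + 2 * t)
    (2 * h + 4 * t - 1) (4 * h + 2 * t + 1).
Definition tent_eo (h t : int) :=
  tent (2 - 2 * h - t) (h - t + 1) (h + 2 * t + 1)
    (2 * h + 4 * t + 1) (4 * h + 2 * t + 1).
Definition tent_oe (h t : int) :=
  tent (1 - 2 * h - t) (h - t - 1) (h + 2 * t - 1)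
    (2 * h + 4 * t + 3) (4 * h + 2 * t + 3).
Definition tent_oo (h t : int) :=
  tent (1 - 2 * h - t) (h - t) (h + 2 * t)
    (2 * h + 4 * t + 5) (4 * h + 2 * t + 3).
Definition tent_e0 (h : int) := tent (2 - 2 * h) h h (2 * h + 1) 0.
Definition tent_o0 (h : int) := tent (1 - 2 * h) h h (2 * h + 3) 0.

Ltac tent_case T := case: T => [?|? ? ? ? ?|? ? ? ? ?|?].

(** The input tent is abstracted to a function [H] known only through its specification; only its
    values at d and at most one neighbour enter each case. *)
Ltac raise_tents :=
  match goal with
  | |- raise _ (tent ?lo ?mid ?hi ?u ?v) ?d = tent ?lo' ?mid' ?hi' ?u' ?v' _ =>
    pose proof (@tentP lo mid hi u v ltac:(lia) ltac:(lia)) as T1;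
    pose proof (@tentP lo' mid' hi' u' v' ltac:(lia) ltac:(lia)) as T2;
    generalize dependent (tent lo mid hi u v); intros H T1;
    case: raiseP => [q e1|q e1|q e1|q e1|q r e1|q r e1|q e1];
    [ tent_case (T1 d); tent_case (T1 (d + 1)); tent_case (T2 d); lia
    | tent_case (T1 d); tent_case (T1 (d + 1)); tent_case (T2 d); lia
    | tent_case (T1 d); tent_case (T1 (d - 1)); tent_case (T2 d); lia
    | tent_case (T1 d); tent_case (T1 (d - 1)); tent_case (T2 d); lia
    | tent_case (T1 d); tent_case (T2 d); lia
    | tent_case (T1 d); tent_case (T2 d); lia
    | tent_case (T1 d); tent_case (T2 d); lia ]
  end.

(** This and the next seven lemmas treat one parity transition each. The colour is the subscript of
    the appended letter: n when lengthening the word of (n, 0) to that of (n + 1, 0), and n + 1 - m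
    when passing from (n, m) to (n, m + 1). *)
Lemma raise_e0 (h d : int) : 1 <= h ->
  raise (2 * h) (tent_e0 h) d = tent_o0 h d.
Proof. move=> h1; rewrite /tent_e0 /tent_o0. raise_tents. Qed.

Lemma raise_o0 (h d : int) : 1 <= h ->
  raise (2 * h + 1) (tent_o0 h) d = tent_e0 (h + 1) d.
Proof. move=> h1; rewrite /tent_e0 /tent_o0. raise_tents. Qed.

Lemma raise_e0o (h d : int) : 1 <= h ->
  raise (2 * h + 1) (tent_e0 h) d = tent_eo h 0 d.
Proof. move=> h1; rewrite /tent_e0 /tent_eo. raise_tents. Qed.

Lemma raise_o0o (h d : int) : 1 <= h ->
  raise (2 * h + 2) (tent_o0 h) d = tent_oo h 0 d.
Proof. move=> h1; rewrite /tent_o0 /tent_oo. raise_tents. Qed.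

Lemma raise_eo (h t d : int) : 1 <= h -> 0 <= t ->
  raise (2 * h - 2 * t) (tent_eo h t) d = tent_ee h (t + 1) d.
Proof. move=> h1 t1; rewrite /tent_eo /tent_ee. raise_tents. Qed.

Lemma raise_ee (h t d : int) : 1 <= h -> 1 <= t ->
  raise (2 * h + 1 - 2 * t) (tent_ee h t) d = tent_eo h t d.
Proof. move=> h1 t1; rewrite /tent_eo /tent_ee. raise_tents. Qed.

Lemma raise_oo (h t d : int) : 1 <= h -> 0 <= t ->
  raise (2 * h + 1 - 2 * t) (tent_oo h t) d = tent_oe h (t + 1) d.
Proof. move=> h1 t1; rewrite /tent_oo /tent_oe. raise_tents. Qed.

Lemma raise_oe (h t d : int) : 1 <= h -> 1 <= t ->
  raise (2 * h + 2 - 2 * t) (tent_oe h t) d = tent_oo h t d.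
Proof. move=> h1 t1; rewrite /tent_oo /tent_oe. raise_tents. Qed.

Lemma eps_even (h : int) : eps (2 * h) = 0.
Proof. by rewrite /eps ifF //; lia. Qed.

Lemma eps_odd (h : int) : eps (2 * h + 1) = 1.
Proof. by rewrite /eps ifT //; lia. Qed.

Lemma channel_size_e0 (h c : int) : channel_size (2 * h) 0 c = 2 * tent_e0 h c.
Proof.
rewrite /channel_size eps_even /tent_e0 /tent eqxx !andTb !andFb.
by case: ifP => h1; case: ifP => h2; try case: ifP => h3; lia.
Qed.

Lemma channel_size_o0 (h c : int) :
  channel_size (2 * h + 1) 0 c = 2 * tent_o0 h c.
Proof.
rewrite /channel_size eps_odd /tent_o0 /tent eqxx !andTb !andFb.
by case: ifP => h1; case: ifP => h2; try case: ifP => h3; lia.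
Qed.

(** For m nonzero the numerators over 6 are even, so halving them gives the quotients by 3 of the
    tents. *)
Lemma channel_size_ee (h t c : int) : 1 <= t ->
  channel_size (2 * h) (2 * t) c = 2 * tent_ee h t c.
Proof.
move=> t_ge; have m0 : ((2 * t : int) == 0) = false by lia.
rewrite /channel_size m0 ?eps_even ?eps_odd /tent_ee /tent !andTb !andFb.
by case: ifP => h1; [|case: ifP => h2]; (case: ifP => h3; [|case: ifP => h4]);
  lia.
Qed.

Lemma channel_size_eo (h t c : int) : 0 <= t ->
  channel_size (2 * h) (2 * t + 1) c = 2 * tent_eo h t c.
Proof.
move=> t_ge; have m0 : ((2 * t + 1 : int) == 0) = false by lia.
rewrite /channel_size m0 ?eps_even ?eps_odd /tent_eo /tent !andTb !andFb.
by case: ifP => h1; [|case: ifP => h2]; (case: ifP => h3; [|case: ifP => h4]);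
  lia.
Qed.

Lemma channel_size_oe (h t c : int) : 1 <= t ->
  channel_size (2 * h + 1) (2 * t) c = 2 * tent_oe h t c.
Proof.
move=> t_ge; have m0 : ((2 * t : int) == 0) = false by lia.
rewrite /channel_size m0 ?eps_even ?eps_odd /tent_oe /tent !andTb !andFb.
by case: ifP => h1; [|case: ifP => h2]; (case: ifP => h3; [|case: ifP => h4]);
  lia.
Qed.

Lemma channel_size_oo (h t c : int) : 0 <= t ->
  channel_size (2 * h + 1) (2 * t + 1) c = 2 * tent_oo h t c.
Proof.
move=> t_ge; have m0 : ((2 * t + 1 : int) == 0) = false by lia.
rewrite /channel_size m0 ?eps_even ?eps_odd /tent_oo /tent !andTb !andFb.
by case: ifP => h1; [|case: ifP => h2]; (case: ifP => h3; [|case: ifP => h4]);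
  lia.
Qed.

(** * Shadows along the word defining (n, m) *)

Definition subscript (i : 'Z_3) (e : int) : Prop := (i%:Z %% 3 = e %% 3)%Z.

Lemma subscript_nat (a : nat) (e : int) :
  (a%:Z %% 3 = e %% 3)%Z -> subscript a%:R e.
Proof. by rewrite /subscript val_Zp_nat //; lia. Qed.

Lemma subscript_sub (a b : nat) (e : int) :
  ((a%:Z - b%:Z) %% 3 = e %% 3)%Z -> subscript (a%:R - b%:R) e.
Proof.
by rewrite /subscript /= !val_Zp_nat //= -[(Zp_trunc 3).+2]/3%N; lia.
Qed.

Lemma cross_subscript (i : 'Z_3) (e k d : int) : subscript i e ->
  cross i (k, d) =
    if ((d + e) %% 3)%Z == 1 then (k, d + 1)
    else if ((d + e) %% 3)%Z == 2 then (k, d - 1)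
    else if ((k + d) %% 2)%Z == 0 then (k + 1, d) else (k - 1, d).
Proof.
rewrite /subscript => h; rewrite /cross.
by have -> : ((d + i%:Z) %% 3 = (d + e) %% 3)%Z by lia.
Qed.

Definition path_word (n m : nat) : word :=
  [seq 0 + j%:R | j <- iota 0 n] ++ [seq n.+1%:R - j%:R | j <- iota 0 m].

Lemma path_word_S n m :
  path_word n m.+1 = rcons (path_word n m) (n.+1%:R - m%:R).
Proof. by rewrite /path_word -(addn1 m) iotaD map_cat /= -cats1 catA. Qed.

Lemma path_word_S0 n : path_word n.+1 0 = rcons (path_word n 0) n%:R.
Proof.
by rewrite /path_word -(addn1 n) iotaD map_cat /= !cats0 -cats1 add0r.
Qed.

(** The symmetry k -> 1 - k is the left action of s_0, a left descent of all the words to which this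
    is applied below. *)
Definition slab (I : word) (H : int -> int) : Prop :=
  forall k d, shade I (k, d) = (1 - H d <= k <= H d).

(** Intervals with the common centre 1/2 are nested, so the union of two adjacent columns has the
    larger height. In a vertical crossing k -> 1 - k flips parity, so the bottom grows exactly when
    the top does, and an empty column stays empty. *)
Lemma slab_rcons I (i : 'Z_3) e H :
  subscript i e -> slab I H -> slab (rcons I i) (raise e H).
Proof.
move=> ie IH k d; rewrite shade_rcons (cross_subscript _ _ ie) IH.
case: raiseP => [q e1|q e1|q e1|q e1|q r e1|q r e1|q e1].
- by rewrite ifT ?IH; lia.
- by rewrite ifT ?IH; lia.
- by rewrite ifF ?ifT ?IH; lia.
- by rewrite ifF ?ifT ?IH; lia.
- by rewrite ifF; [rewrite ifF; [case: ifP => ?; rewrite IH; lia|lia]|lia].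
- by rewrite ifF; [rewrite ifF; [case: ifP => ?; rewrite IH; lia|lia]|lia].
- by rewrite ifF; [rewrite ifF; [case: ifP => ?; rewrite IH; lia|lia]|lia].
Qed.

Lemma slab_eq I H H' : H =1 H' -> slab I H -> slab I H'.
Proof. by move=> e IH k d; rewrite IH e. Qed.

(** Induction by two letters along gamma_0(n), starting at n = 2. The end cell is carried along
    because its [dist] later certifies that the word is reduced. *)
Lemma slab_path0 (h : nat) :
  [/\ slab (path_word h.+1.*2 0) (tent_e0 h.+1),
      endcell (path_word h.+1.*2 0) = (h.+1%:Z, h.+1%:Z),
      slab (path_word h.+1.*2.+1 0) (tent_o0 h.+1)
    & endcell (path_word h.+1.*2.+1 0) = (h.+2%:Z, h.+1%:Z)].
Proof.
suff [he ce] : slab (path_word h.+1.*2 0) (tent_e0 h.+1) /\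
    endcell (path_word h.+1.*2 0) = (h.+1%:Z, h.+1%:Z).
  have ei : subscript h.+1.*2%:R (2 * h.+1%:Z).
    by apply: subscript_nat; lia.
  split=> //; rewrite path_word_S0.
    by apply: slab_eq (slab_rcons ei he) => d; rewrite raise_e0 //; lia.
  rewrite endcell_rcons ce (cross_subscript _ _ ei) ifF; [|lia].
  by rewrite ifF; [rewrite ifT; [congr pair; lia|lia]|lia].
elim: h => [|h [he ce]].
  have -> : path_word 1.*2 0 = [:: 0; 1].
    by rewrite /path_word /= !add0r.
  split; last by [].
  move=> k d; rewrite -[[:: 0; 1]]/(rcons (rcons [::] 0) 1).
  rewrite !shade_rcons !shade_nil.
  (* Moving the crossings to the other side of the equalities exhibits the shadow of s_0 s_1 as four
     explicit cells. *)
  rewrite !(inv_eq (@crossK _)).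
  have -> : cross 0 (0, 0) = (1, 0) by [].
  have -> : cross 1 (0, 0) = (0, 1) by [].
  have -> : cross 1 (1, 0) = (1, 1) by [].
  rewrite !xpair_eqE /tent_e0; case: tentP; lia.
have ei : subscript h.+1.*2%:R (2 * h.+1%:Z).
    by apply: subscript_nat; lia.
have ei' : subscript h.+1.*2.+1%:R (2 * h.+1%:Z + 1).
  by apply: subscript_nat; lia.
have -> : h.+2.*2 = h.+1.*2.+2 by lia.
rewrite 2!path_word_S0; split.
  have hm := slab_eq (fun d => raise_e0 d (isT : 1 <= h.+1%:Z))
      (slab_rcons ei he).
  apply: slab_eq (slab_rcons ei' hm) => d; rewrite raise_o0 //.
  by congr tent_e0; lia.
rewrite !endcell_rcons ce (cross_subscript _ _ ei) ifF; [|lia].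
rewrite ifF; [|lia]; rewrite ifT; [|lia].
by rewrite (cross_subscript _ _ ei') ifT; [congr pair; lia|lia].
Qed.

(** For even n the letters of delta_{n+1} walk along the row k = n/2 with d increasing. *)
Lemma slab_path_even (h t : nat) :
  [/\ slab (path_word h.+1.*2 t.*2.+1) (tent_eo h.+1 t),
      endcell (path_word h.+1.*2 t.*2.+1) = (h.+1%:Z, h.+1%:Z + t%:Z *+ 2 + 1),
      slab (path_word h.+1.*2 t.*2.+2) (tent_ee h.+1 t.+1)
    & endcell (path_word h.+1.*2 t.*2.+2) = (h.+1%:Z, h.+1%:Z + t%:Z *+ 2 + 2)].
Proof.
suff [he ce] : slab (path_word h.+1.*2 t.*2.+1) (tent_eo h.+1 t) /\
      endcell (path_word h.+1.*2 t.*2.+1) = (h.+1%:Z, h.+1%:Z + t%:Z *+ 2 + 1).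
  have ei : subscript (h.+1.*2.+1%:R - t.*2.+1%:R) (2 * h.+1%:Z - 2 * t%:Z).
    by apply: subscript_sub; lia.
  split=> //; rewrite path_word_S.
    apply: slab_eq (slab_rcons ei he) => d; rewrite raise_eo //.
    by congr tent_ee; lia.
  rewrite endcell_rcons ce (cross_subscript _ _ ei).
  by rewrite ifT; [congr pair; lia|lia].
elim: t => [|t [he ce]].
  have [he ce _ _] := slab_path0 h.
  have ei : subscript (h.+1.*2.+1%:R - 0%:R) (2 * h.+1%:Z + 1).
    by apply: subscript_sub; lia.
  rewrite path_word_S; split.
    by apply: slab_eq (slab_rcons ei he) => d; rewrite raise_e0o //; lia.
  rewrite endcell_rcons ce (cross_subscript _ _ ei).
  by rewrite ifT; [congr pair; lia|lia].
have ei : subscript (h.+1.*2.+1%:R - t.*2.+1%:R) (2 * h.+1%:Z - 2 * t%:Z).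
  by apply: subscript_sub; lia.
have ei' : subscript (h.+1.*2.+1%:R - t.*2.+2%:R)
    (2 * h.+1%:Z + 1 - 2 * (t%:Z + 1)).
  by apply: subscript_sub; lia.
have -> : t.+1.*2.+1 = t.*2.+3 by lia.
rewrite 2!path_word_S; split.
  have t1 : t%:Z + 1 = t.+1%:Z by lia.
  have hm := slab_eq
      (fun d => raise_eo d (isT : 1 <= h.+1%:Z) (isT : 0 <= t%:Z))
      (slab_rcons ei he).
  rewrite t1 in hm ei'.
  by apply: slab_eq (slab_rcons ei' hm) => d; rewrite raise_ee.
rewrite !endcell_rcons ce (cross_subscript _ _ ei) ifT; [|lia].
by rewrite (cross_subscript _ _ ei') ifT; [congr pair; lia|lia].
Qed.

(** For odd n the letters of delta_{n+1} alternately lower d and raise k. *)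
Lemma slab_path_odd (h t : nat) :
  [/\ slab (path_word h.+1.*2.+1 t.*2.+1) (tent_oo h.+1 t),
      endcell (path_word h.+1.*2.+1 t.*2.+1) = (h.+2%:Z + t%:Z, h%:Z - t%:Z),
      slab (path_word h.+1.*2.+1 t.*2.+2) (tent_oe h.+1 t.+1)
    & endcell (path_word h.+1.*2.+1 t.*2.+2) = (h.+3%:Z + t%:Z, h%:Z - t%:Z)].
Proof.
suff [he ce] : slab (path_word h.+1.*2.+1 t.*2.+1) (tent_oo h.+1 t) /\
      endcell (path_word h.+1.*2.+1 t.*2.+1) = (h.+2%:Z + t%:Z, h%:Z - t%:Z).
  have ei : subscript (h.+1.*2.+2%:R - t.*2.+1%:R) (2 * h.+1%:Z + 1 - 2 * t%:Z).
    by apply: subscript_sub; lia.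
  split=> //; rewrite path_word_S.
    apply: slab_eq (slab_rcons ei he) => d; rewrite raise_oo //.
    by congr tent_oe; lia.
  rewrite endcell_rcons ce (cross_subscript _ _ ei) ifF; [|lia].
  by rewrite ifF; [rewrite ifT; [congr pair; lia|lia]|lia].
elim: t => [|t [he ce]].
  have [_ _ he ce] := slab_path0 h.
  have ei : subscript (h.+1.*2.+2%:R - 0%:R) (2 * h.+1%:Z + 2).
    by apply: subscript_sub; lia.
  rewrite path_word_S; split.
    by apply: slab_eq (slab_rcons ei he) => d; rewrite raise_o0o //; lia.
  rewrite endcell_rcons ce (cross_subscript _ _ ei) ifF; [|lia].
  by rewrite ifT; [congr pair; lia|lia].
have ei : subscript (h.+1.*2.+2%:R - t.*2.+1%:R) (2 * h.+1%:Z + 1 - 2 * t%:Z).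
  by apply: subscript_sub; lia.
have ei' : subscript (h.+1.*2.+2%:R - t.*2.+2%:R)
    (2 * h.+1%:Z + 2 - 2 * (t%:Z + 1)).
  by apply: subscript_sub; lia.
have -> : t.+1.*2.+1 = t.*2.+3 by lia.
rewrite 2!path_word_S; split.
  have t1 : t%:Z + 1 = t.+1%:Z by lia.
  have hm := slab_eq
      (fun d => raise_oo d (isT : 1 <= h.+1%:Z) (isT : 0 <= t%:Z))
      (slab_rcons ei he).
  rewrite t1 in hm ei'.
  by apply: slab_eq (slab_rcons ei' hm) => d; rewrite raise_oe.
rewrite !endcell_rcons ce (cross_subscript _ _ ei) ifF; [|lia].
rewrite ifF; [|lia]; rewrite ifT; [|lia].
rewrite (cross_subscript _ _ ei') ifF; [|lia].
by rewrite ifT; [congr pair; lia|lia].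
Qed.

Lemma a_path_word (n m : nat) : a_ n m = wprod (path_word n m).
Proof.
have n1 : n%:Z + 1 = n.+1%:Z by lia.
by rewrite /a_ /b_ /c_ n1 /= /gamma_ /delta_ /path_word /wprod big_cat.
Qed.

(** Shortness holds because n + m equals [dist] of the end cell. Nonnegativity of H is recorded
    because only then does the interval from 1 - H to H have 2 H elements. *)
Lemma a_slab (n m : int) : 2 <= n -> 0 <= m -> exists I H,
  [/\ short I, wprod I = a_ n m, slab I H
    & forall c, 0 <= H c /\ channel_size n m c = 2 * H c].
Proof.
case: n => // n; case: m => // m n2 _.
have [h [nh|nh]] : exists h, n = h.+1.*2 \/ n = h.+1.*2.+1.
  by exists (n./2.-1); case on: (odd n); [right|left]; lia.
  have n2h : n%:Z = 2 * h.+1%:Z by lia.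
  have [m0|[t [mt|mt]]] : m = 0%N \/ exists t, m = t.*2.+1 \/ m = t.*2.+2.
  - case: m => [|m]; [by left|right; exists m./2].
    by case om: (odd m); [right|left]; lia.
  - have [he ce _ _] := slab_path0 h.
    exists (path_word h.+1.*2 0), (tent_e0 h.+1); split => //.
    + by rewrite /short ce size_cat !size_map !size_iota /dist /=; lia.
    + by rewrite -a_path_word nh m0.
    + move=> c; rewrite m0 n2h channel_size_e0; split=> //.
      by rewrite /tent_e0; case: tentP; lia.
  - have [he ce _ _] := slab_path_even h t.
    exists (path_word h.+1.*2 t.*2.+1), (tent_eo h.+1 t); split => //.
    + by rewrite /short ce size_cat !size_map !size_iota /dist /=; lia.
    + by rewrite -a_path_word nh mt.
    + move=> c; rewrite n2h (_ : m%:Z = 2 * t%:Z + 1) ?channel_size_eo //;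
        last by lia.
      by split=> //; rewrite /tent_eo; case: tentP; lia.
  - have [_ _ he ce] := slab_path_even h t.
    exists (path_word h.+1.*2 t.*2.+2), (tent_ee h.+1 t.+1); split => //.
    + by rewrite /short ce size_cat !size_map !size_iota /dist /=; lia.
    + by rewrite -a_path_word nh mt.
    + move=> c; rewrite n2h (_ : m%:Z = 2 * t.+1%:Z) ?channel_size_ee //;
        last by lia.
      by split=> //; rewrite /tent_ee; case: tentP; lia.
have n2h : n%:Z = 2 * h.+1%:Z + 1 by lia.
have [m0|[t [mt|mt]]] : m = 0%N \/ exists t, m = t.*2.+1 \/ m = t.*2.+2.
- case: m => [|m]; [by left|right; exists m./2].
  by case om: (odd m); [right|left]; lia.
- have [_ _ he ce] := slab_path0 h.
  exists (path_word h.+1.*2.+1 0), (tent_o0 h.+1); split => //.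
  + by rewrite /short ce size_cat !size_map !size_iota /dist /=; lia.
  + by rewrite -a_path_word nh m0.
  + move=> c; rewrite m0 n2h channel_size_o0; split=> //.
    by rewrite /tent_o0; case: tentP; lia.
- have [he ce _ _] := slab_path_odd h t.
  exists (path_word h.+1.*2.+1 t.*2.+1), (tent_oo h.+1 t); split => //.
  + by rewrite /short ce size_cat !size_map !size_iota /dist /=; lia.
  + by rewrite -a_path_word nh mt.
  + move=> c; rewrite n2h (_ : m%:Z = 2 * t%:Z + 1) ?channel_size_oo //;
      last by lia.
    by split=> //; rewrite /tent_oo; case: tentP; lia.
- have [_ _ he ce] := slab_path_odd h t.
  exists (path_word h.+1.*2.+1 t.*2.+2), (tent_oe h.+1 t.+1); split => //.
  + by rewrite /short ce size_cat !size_map !size_iota /dist /=; lia.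
  + by rewrite -a_path_word nh mt.
  + move=> c; rewrite n2h (_ : m%:Z = 2 * t.+1%:Z) ?channel_size_oe //;
      last by lia.
    by split=> //; rewrite /tent_oe; case: tentP; lia.
Qed.

(** Starting from the identity, both delta_1 and gamma_2 stay in the row k = 0, the first with d
    increasing and the second with d decreasing. *)
Lemma cellW_a0 (c : int) : cellW (a_ 0 c) = (0, c).
Proof.
case: c => c.
  rewrite (a_path_word 0 c) cellW_wprod; elim: c => [//|c IHc].
  have ei : subscript (1%:R - c%:R) (1 - c%:Z).
    by apply: subscript_sub; lia.
  rewrite path_word_S endcell_rcons IHc (cross_subscript _ _ ei) ifT; [|lia].
  by congr pair; lia.
have -> : a_ 0 (Negz c) = wprod [seq 2%:R + j%:R | j <- iota 0 c.+1].
  by rewrite /a_ /b_ /c_ /gamma_ {1}/wprod /= big_nil mul1g.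
rewrite cellW_wprod NegzE; elim: c.+1 => [//|{}c IHc].
have ei : subscript (2%:R + c%:R) (2 + c%:Z).
  by rewrite -natrD; apply: subscript_nat; lia.
rewrite -(addn1 c) iotaD map_cat /= cats1 endcell_rcons IHc.
rewrite (cross_subscript _ _ ei).
by rewrite ifF; [rewrite ifT; [congr pair; lia|lia]|lia].
Qed.

Unset Implicit Arguments.
Set Strict Implicit.

Theorem proposition6p5 (R : realType) (alpha beta : 'rV[R]_3)
    (simple : A2_simple alpha beta) (n m c : int) (hn : 2 <= n) (hm : 0 <= m) :
  let S := channel alpha beta (alpha + beta) (a_ 0 c) `&` shadow (a_ n m) in
  finite_set S /\ (#|` fset_set S|%fset)%:Z = channel_size n m c.
Proof.
move=> S; have [I [H [sI wI sH hH]]] := a_slab hn hm; have [H_ge0 ->] := hH c.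
have [f fK] := choice cellW_surj.
pose N := `|(2 * H c)%R|%N.
(* The column is listed upwards from its bottom cell k = 1 - H c, through a section [f] of
   [cellW]. *)
pose g (j : nat) : W := f (1 - H c + j%:Z, c).
have g_inj : injective g.
  by move=> j k /(congr1 cellW); rewrite !fK => -[]; lia.
have -> : S = [set` [fset x in [seq g j | j <- iota 0 N]]%fset].
  apply/seteqP; split=> x /=.
    move=> [/(channel_theta simple)]; rewrite cellW_a0 -wI /= => xc.
    move=> /(shadow_shade _ sI).
    rewrite [cellW x]surjective_pairing xc sH => kb.
    rewrite !inE; apply/mapP; exists `|((cellW x).1 - (1 - H c))%R|%N.
      by rewrite mem_iota /N; lia.
    by apply: cellW_inj; rewrite fK [LHS]surjective_pairing xc; congr pair; lia.
  rewrite !inE => /mapP[j]; rewrite mem_iota /N => jN ->; split.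
    by apply/(channel_theta simple); rewrite cellW_a0 fK.
  by rewrite -wI; apply/(shadow_shade _ sI); rewrite fK sH; lia.
split; first exact: finite_fset.
rewrite set_fsetK card_fseq undup_id ?map_inj_uniq ?iota_uniq //.
by rewrite size_map size_iota /N; lia.
Qed.
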